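(* Let $(Y_i)_{i\in\mathbb Z}$ be a strictly stationary sequence of real-valued random variables with marginal density $f$ with respect to Lebesgue measure $\lambda$ on $\mathbb R$. Let $r\ge0$ be an integer, $(m_n)_{n\ge1}$ a sequence of positive integers, and let $f_n$ be the piecewise polynomial estimator of order $r$ on the regular partition of $]0,1]$ into $m_n$ intervals, built from functions $R_1,\dots,R_{r+1}$ (see context). Let $C_{1,2}=\sum_{i=1}^{r+1}\|R_i\|_\infty^3\|dR_i\|$ and $V_{1,2,Y}(n)=\sum_{k=0}^n\beta_{1,Y}(k)$. Let $1\le p\le2$. Then there is a constant $C>0$ not depending on $n$ such that for all positive integers $n$, $$\mathbb E\Big(\int_0^1|f_n(x)-\mathbb E(f_n(x))|^p\,dx\Big)\le C\Big(\frac{m_n}n\Big)^{\frac p2}C_{1,2}^{\frac p2}\,(V_{1,2,Y}(n))^{\frac p2}.$$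
   Context: Estimator: let $(Q_i)_{1\le i\le r+1}$ be an orthonormal basis (in $\mathbb L^2([0,1],\lambda)$) of the space of polynomials of order $r$ (degree at most $r$) on $[0,1]$; set $R_i(x)=Q_i(x)$ if $x\in]0,1]$ and $R_i(x)=0$ otherwise. For $1\le i\le r+1$, $1\le j\le m_n$, let $\varphi_{i,j}(x)=\sqrt{m_n}\,R_i(m_nx-(j-1))$, and $$X_{i,j,n}=\frac1n\sum_{k=1}^n\varphi_{i,j}(Y_k),\qquad f_n=\sum_{i=1}^{r+1}\sum_{j=1}^{m_n}X_{i,j,n}\varphi_{i,j}.$$ $\|dR_i\|$ is the total variation norm of the measure $dR_i$ on $\mathbb R$. Dependence coefficients: let $P$ be the law of $Y_0$, $\mathcal F_\ell=\sigma(Y_i,i\le\ell)$, and let $P_{Y_k|\mathcal F_\ell}$ be the conditional distribution of $Y_k$ given $\mathcal F_\ell$. With $f_t=\mathbf 1_{]-\infty,t]}$ for $t\in\mathbb R$ and $Q(g)=\int g\,dQ$, let $b_\ell(k)=\sup_{t\in\mathbb R}|P_{Y_k|\mathcal F_\ell}(f_t)-P(f_t)|$ and $\beta_{1,Y}(k)=\mathbb E(b_0(k))$. *)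

(* Defs.v *)
From HB Require Import structures.
From mathcomp Require Export all_boot all_order all_algebra.
From mathcomp Require Export all_classical all_reals all_analysis.

Set Implicit Arguments.
Unset Strict Implicit.
Unset Printing Implicit Defensive.

Import Order.TTheory GRing.Theory Num.Theory.
Import numFieldNormedType.Exports.

Local Open Scope classical_set_scope.
Local Open Scope ring_scope.

(* Equality of all finite-dimensional laws under time shifts; the time points
   may be in any order and may repeat. *)
Definition strictly_stationary d (T : measurableType d) (R : realType)
    (P : probability T R) (Y : int -> {RV P >-> R}) : Prop :=
  forall (n : nat) (t : 'I_n -> int) (h : int) (B : set (n.-tuple R)),
    measurable B ->
    P ((fun w => [tuple Y (t i + h) w | i < n]) @^-1` B) =
    P ((fun w => [tuple Y (t i) w | i < n]) @^-1` B).

Definition has_density d (T : measurableType d) (R : realType)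
    (P : probability T R) (X : {RV P >-> R}) (f : R -> R) : Prop :=
  [/\ measurable_fun setT f, forall x, 0 <= f x &
      forall B : set R, measurable B ->
        distribution P X B = (\int[lebesgue_measure]_(x in B) (f x)%:E)%E].

Definition poly_orthonormal_basis (R : realType) (r : nat)
    (Q : 'I_r.+1 -> {poly R}) : Prop :=
  [/\ forall i, (size (Q i) <= r.+1)%N,
      forall i j, (\int[lebesgue_measure]_(x in `[0%R, 1%R])
                     ((Q i).[x] * (Q j).[x])%:E)%E = ((i == j)%:R)%:E &
      forall q : {poly R}, (size q <= r.+1)%N ->
        exists c : 'I_r.+1 -> R, q = \sum_(i < r.+1) c i *: Q i].

Definition cut_poly (R : realType) (q : {poly R}) (x : R) : R :=
  if (0 < x) && (x <= 1) then q.[x] else 0.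

Section estimator.
Context (R : realType) (r : nat) (Q : 'I_r.+1 -> {poly R}).

Definition phi (m : nat) (i : 'I_r.+1) (j : nat) (x : R) : R :=
  Num.sqrt m%:R * cut_poly (Q i) (m%:R * x - (j%:R - 1)).

Context d (T : measurableType d) (P : probability T R)
  (Y : int -> {RV P >-> R}).

Definition emp_coef (m n : nat) (i : 'I_r.+1) (j : nat) (w : T) : R :=
  n%:R^-1 * \sum_(1 <= k < n.+1) phi m i j (Y k%:Z w).

Definition estimator (m n : nat) (w : T) (x : R) : R :=
  \sum_(i < r.+1) \sum_(1 <= j < m.+1) emp_coef m n i j w * phi m i j x.

End estimator.

Section norms.
Context (R : realType).
Local Open Scope ereal_scope.

Definition sup_norm (g : R -> R) : \bar R :=
  ereal_sup [set `|g x|%:E | x in [set: R]].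

(* nu is the signed measure dg for a left-continuous g of bounded variation.
   The functions cut_poly q are left-continuous (they are cut on ]0, 1]),
   hence the half-open intervals closed on the left. *)
Definition is_differential (g : R -> R) (nu : {charge set R -> \bar R}) : Prop :=
  forall a b : R, (a <= b)%R -> nu `[a, b[%classic = (g b - g a)%:E.

(* The value does not depend on the chosen Hahn decomposition. *)
Definition tv_norm (nu : {charge set R -> \bar R}) : \bar R :=
  let P := cid (Hahn_decomposition nu) in
  let N := cid (projT2 P) in
  charge_variation (projT2 N) setT.

Definition C12 r (Q : 'I_r.+1 -> {poly R})
    (dR : 'I_r.+1 -> {charge set R -> \bar R}) : \bar R :=
  \sum_(i < r.+1) sup_norm (cut_poly (Q i)) ^+ 3 * tv_norm (dR i).

End norms.

Section dependence.
Context d (T : measurableType d) (R : realType) (P : probability T R)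
  (Y : int -> {RV P >-> R}).
Local Open Scope ereal_scope.

Definition past_events (l : int) : set (set T) :=
  \bigcup_(i in [set i : int | (i <= l)%R])
    preimage_set_system setT (Y i) measurable.

Definition past (l : int) := g_sigma_algebraType (past_events l).

(* kappa is a version of the conditional distribution of X given F_l; its
   F_l-measurability is part of the type of kappa. *)
Definition is_cond_distribution (l : int) (X : {RV P >-> R})
    (kappa : R.-pker (past l) ~> R) : Prop :=
  forall (A : set T) (B : set R), <<s past_events l >> A -> measurable B ->
    \int[P]_(w in A) kappa w B = P (A `&` X @^-1` B).

Definition b_coef (l : int) (kappa : R.-pker (past l) ~> R) (w : T) : \bar R :=
  ereal_sup [set `| \int[kappa w]_x (\1_(`]-oo, t]%classic : set R) x)%:E
                    - \int[distribution P (Y 0)]_x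
                        (\1_(`]-oo, t]%classic : set R) x)%:E |
            | t in [set: R]].

Definition beta1 (kappa : nat -> R.-pker (past 0) ~> R) (k : nat) : \bar R :=
  \int[P]_w b_coef (kappa k) w.

Definition V12 (kappa : nat -> R.-pker (past 0) ~> R) (n : nat) : \bar R :=
  \sum_(0 <= k < n.+1) beta1 kappa k.

End dependence.

(* Main.v *)
Require Import Defs.
From mathcomp Require Import measurable_realfun ring lra zify.
Set Implicit Arguments.
Unset Strict Implicit.
Unset Printing Implicit Defensive.
Import Order.TTheory GRing.Theory Num.Theory.
Import numFieldNormedType.Exports.
Local Open Scope classical_set_scope.
Local Open Scope ring_scope.

(** Second moments suffice.  For p <= 2 and every s > 0 one has
    a^p <= s^p + s^(p-2) a^2 for all a >= 0 ([powR_le_split]); applied to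
    a = |f_n(x) - E f_n(x)| and integrated, with s^2 equal to a bound D of the
    mean integrated squared error, it gives the bound 2 D^(p/2)
    ([optimize_split]).

    The functions phi_{i,j} are orthonormal on the unit interval, so the
    integrated squared error is the sum over i and j of the squares of
    X_{i,j,n} - E X_{i,j,n} ([integral_phi_sqr]), and D may be any bound of the
    sum of their variances.  By stationarity, the variance of X_{i,j,n} is at
    most 2/n times the sum over the lags h <= n of the absolute covariances of
    phi_{i,j}(Y_0) and phi_{i,j}(Y_h) ([variance_average_le]).

    The covariances are bounded by conditioning on the past ([sum_cov_le]).
    The function phi_{i,j} is a mixture of indicators of half-lines of total
    mass m^(1/2) |dR_i|, and the conditional mean of such an indicator at Y_h
    differs from its mean by at most b_0(h); so the covariance is at most
    m^(1/2) |dR_i| E(|phi_{i,j}(Y_0)| b_0(h)).  The supports of the phi_{i,j}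
    are disjoint for distinct j, so that the sum over j of the
    |phi_{i,j}(Y_0)| is at most m^(1/2) times the sup norm of R_i
    ([sum_phi_le]).  Altogether ([sum_variance_le]) the sum of the variances is
    at most 2 (m/n) V_{1,2,Y}(n) times the sum over i of |R_i|_oo |dR_i|; since
    R_i has unit L2 norm, its sup norm is at least 1 and may be cubed
    ([unit_sup_norm_ge1]).

    The mixture is used in a finitary form: phi_{i,j} is a uniform limit of
    finite combinations of indicators of half-lines whose weights have total
    mass at most m^(1/2) |dR_i| ([cut_poly_step_approximable]).  The identities
    on conditional means are checked on indicators and passed to the limit. *)

(** * Means of bounded measurable functions *)

(** The integral of a nonnegative function is a supremum over the simple
    functions below it, hence it is monotone without any measurability.  This
    spares a measurability proof for [b_coef], a supremum over uncountably
    many thresholds. *)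
Lemma ge0_le_integral_nomeas d (T : measurableType d) (R : realType)
    (mu : {measure set T -> \bar R}) (D : set T) (f g : T -> \bar R) :
  (forall x, D x -> 0 <= f x)%E -> (forall x, D x -> f x <= g x)%E ->
  (\int[mu]_(x in D) f x <= \int[mu]_(x in D) g x)%E.
Proof.
move=> f0 fg; have g0 x : D x -> (0 <= g x)%E.
  by move=> Dx; apply: le_trans (fg x Dx); exact: f0.
rewrite !ge0_integralE//; apply: ge_ereal_sup => _ [h hf <-].
apply: ereal_sup_ubound; exists h => // x; apply: le_trans (hf x) _.
exact: lee_restrict.
Qed.

Section bounded_mfun.
Context d (T : measurableType d) (R : realType) (P : probability T R).
Implicit Types X Z : T -> R.

(** Everything integrated below against [P] is bounded, so that integrability
    follows from closure of this class under the ring operations. *)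
Definition bounded_mfun X :=
  measurable_fun setT X /\ exists M, forall w, `|X w| <= M.

Lemma bounded_mfun_cst c : bounded_mfun (fun=> c).
Proof. by split; [exact: measurable_cst|exists `|c|]. Qed.

Lemma bounded_mfunD X Z :
  bounded_mfun X -> bounded_mfun Z -> bounded_mfun (fun w => X w + Z w).
Proof.
move=> [mX [M XM]] [mZ [N ZN]]; split; first exact: measurable_funD.
by exists (M + N) => w; rewrite (le_trans (ler_normD _ _))// lerD.
Qed.

Lemma bounded_mfunM X Z :
  bounded_mfun X -> bounded_mfun Z -> bounded_mfun (fun w => X w * Z w).
Proof.
move=> [mX [M XM]] [mZ [N ZN]]; split; first exact: measurable_funM.
by exists (M * N) => w; rewrite normrM ler_pM.
Qed.

Lemma bounded_mfunZ c X : bounded_mfun X -> bounded_mfun (fun w => c * X w).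
Proof. by apply: bounded_mfunM; exact: bounded_mfun_cst. Qed.

Lemma bounded_mfunN X : bounded_mfun X -> bounded_mfun (fun w => - X w).
Proof.
by move=> [mX [M XM]]; split; [exact: measurable_funN|
  exists M => w; rewrite normrN].
Qed.

Lemma bounded_mfunB X Z :
  bounded_mfun X -> bounded_mfun Z -> bounded_mfun (fun w => X w - Z w).
Proof. by move=> bX bZ; apply: bounded_mfunD => //; exact: bounded_mfunN. Qed.

Lemma bounded_mfun_norm X : bounded_mfun X -> bounded_mfun (fun w => `|X w|).
Proof.
move=> [mX [M XM]]; split; first exact: measurableT_comp.
by exists M => w; rewrite normr_id.
Qed.

Lemma bounded_mfun_sum I (s : seq I) (F : I -> T -> R) :
  (forall i, bounded_mfun (F i)) -> bounded_mfun (fun w => \sum_(i <- s) F i w).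
Proof.
move=> bF; elim: s => [|i s IH].
  by under eq_fun do rewrite big_nil; exact: bounded_mfun_cst.
by under eq_fun do rewrite big_cons; exact: bounded_mfunD.
Qed.

Lemma bounded_mfun_integrable X : bounded_mfun X -> P.-integrable setT (EFin \o X).
Proof.
move=> [mX [M XM]]; apply: measurable_bounded_integrable => //.
  by apply: fin_num_fun_lty; exact: fin_num_measure.
by exists M; split; [exact: num_real|move=> x Mx w _ /=; apply: le_trans (ltW Mx)].
Qed.

Lemma bounded_mfun_integral X : bounded_mfun X ->
  (\int[P]_w (X w)%:E)%E = (\int[P]_w X w)%:E.
Proof.
move=> bX; rewrite /Rintegral fineK//.
exact: (integrable_fin_num _ (bounded_mfun_integrable bX)).
Qed.

Lemma mean_cst c : \int[P]_w (fun=> c) w = c.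
Proof. by rewrite Rintegral_cst//= probability_setT/= mulr1. Qed.

Lemma meanD X Z : bounded_mfun X -> bounded_mfun Z ->
  \int[P]_w (X w + Z w) = \int[P]_w X w + \int[P]_w Z w.
Proof.
by move=> bX bZ; rewrite RintegralD//; exact: bounded_mfun_integrable.
Qed.

Lemma meanB X Z : bounded_mfun X -> bounded_mfun Z ->
  \int[P]_w (X w - Z w) = \int[P]_w X w - \int[P]_w Z w.
Proof.
by move=> bX bZ; rewrite RintegralB//; exact: bounded_mfun_integrable.
Qed.

Lemma meanZl c X : bounded_mfun X ->
  \int[P]_w (c * X w) = c * \int[P]_w X w.
Proof. by move=> bX; rewrite RintegralZl//; exact: bounded_mfun_integrable. Qed.

Lemma mean_sum I (s : seq I) (F : I -> T -> R) :
  (forall i, bounded_mfun (F i)) ->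
  \int[P]_w (\sum_(i <- s) F i w) = \sum_(i <- s) \int[P]_w F i w.
Proof.
move=> bF; elim: s => [|i s IH].
  rewrite big_nil; under eq_Rintegral do rewrite big_nil.
  exact: (mean_cst 0).
rewrite big_cons -IH -meanD//; last exact: bounded_mfun_sum.
by under eq_Rintegral do rewrite big_cons.
Qed.

Lemma le_mean X Z : bounded_mfun X -> bounded_mfun Z ->
  (forall w, X w <= Z w) -> \int[P]_w X w <= \int[P]_w Z w.
Proof.
by move=> bX bZ XZ; apply: le_Rintegral => //; exact: bounded_mfun_integrable.
Qed.

Lemma mean_norm X : bounded_mfun X -> `|\int[P]_w X w| <= \int[P]_w `|X w|.
Proof.
by move=> bX; apply: le_normr_Rintegral => //; exact: bounded_mfun_integrable.
Qed.

Lemma mean_dist X Z e : bounded_mfun X -> bounded_mfun Z ->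
  (forall w, `|X w - Z w| <= e) -> `|\int[P]_w X w - \int[P]_w Z w| <= e.
Proof.
move=> bX bZ XZ; rewrite -meanB//; apply: le_trans (mean_norm _) _.
  exact: bounded_mfunB.
rewrite -[leRHS](mean_cst e); apply: le_mean => //.
  by apply: bounded_mfun_norm; exact: bounded_mfunB.
exact: bounded_mfun_cst.
Qed.

End bounded_mfun.

(** * Cut polynomials as mixtures of half-line indicators *)

Section cut_poly.
Context (R : realType).
Implicit Types (q : {poly R}) (g : R -> R).

Lemma poly_lipschitz01 q : exists2 L, 0 <= L &
  forall x y, 0 <= x <= 1 -> 0 <= y <= 1 -> `|q.[x] - q.[y]| <= L * `|x - y|.
Proof.
elim/poly_ind: q => [|q c [L L0 qL]].
  by exists 0 => // x y _ _; rewrite !horner0 subrr normr0 mul0r.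
exists (L + (`|q.[0]| + L)); first by rewrite !addr_ge0.
move=> x y x01 y01; rewrite !hornerMXaddC.
have -> : q.[x] * x + c - (q.[y] * y + c) =
  (q.[x] - q.[y]) * x + q.[y] * (x - y) by ring.
rewrite (le_trans (ler_normD _ _))// !normrM mulrDl lerD//.
  rewrite -[leRHS]mulr1 ler_pM//; first exact: qL.
  by case/andP: x01 => x0 x1; rewrite ger0_norm.
rewrite ler_wpM2r//.
have := qL y 0 y01; rewrite lexx ler01 subr0 => /(_ isT) h.
have -> : q.[y] = q.[0] + (q.[y] - q.[0]) by ring.
rewrite (le_trans (ler_normD _ _))// lerD2l (le_trans h)//.
by case/andP: y01 => y0 y1; rewrite ger0_norm// ler_piMr.
Qed.

Lemma cut_polyE q x : 0 < x <= 1 -> cut_poly q x = q.[x].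
Proof. by rewrite /cut_poly => ->. Qed.

Lemma cut_poly_out q x : ~~ (0 < x <= 1) -> cut_poly q x = 0.
Proof. by rewrite /cut_poly => /negPf ->. Qed.

Lemma bounded_cut_poly q : exists M, forall x, `|cut_poly q x| <= M.
Proof.
have [L L0 qL] := poly_lipschitz01 q; exists (`|q.[0]| + L) => x.
have [x01|x01] := boolP (0 < x <= 1); last first.
  by rewrite cut_poly_out// normr0 addr_ge0.
rewrite cut_polyE//; case/andP: x01 => x0 x1.
have -> : q.[x] = q.[0] + (q.[x] - q.[0]) by ring.
rewrite (le_trans (ler_normD _ _))// lerD2l.
have := qL x 0; rewrite (ltW x0) x1 lexx ler01 subr0 => /(_ isT isT) h.
by rewrite (le_trans h)// ger0_norm ?(ltW x0)// ler_piMr.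
Qed.

Lemma measurable_cut_poly q : measurable_fun setT (cut_poly q).
Proof.
rewrite /cut_poly; apply: measurable_fun_ifT => //.
- by apply: measurable_and; [exact: measurable_fun_ltr|exact: measurable_fun_ler].
- exact: measurable_poly.
Qed.

(** A combination of indicators of half-lines ]-oo, t]: the pairs of the list
    hold a weight and a threshold. *)
Definition step (s : seq (R * R)) (x : R) : R :=
  \sum_(a <- s) a.1 * (x <= a.2)%R%:R.

(** A uniform, finitary substitute for writing [g] as an integral of half-line
    indicators against a signed measure of total mass [V]: an identity about
    the indicators transfers to [g] by linearity and a uniform limit, without
    a Fubini theorem for signed measures. *)
Definition step_approximable (V : R) g := forall e, 0 < e ->
  exists2 s : seq (R * R), \sum_(a <- s) `|a.1| <= V &
    forall x, `|g x - step s x| <= e.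

Lemma step_approximable_affine V g c m b : 0 <= c -> 0 < m ->
  step_approximable V g ->
  step_approximable (c * V) (fun x => c * g (m * x - b)).
Proof.
move=> c0 m0 gV e e0.
have c10 : 0 < c + 1 by rewrite ltr_wpDl.
have [s sV gs] := gV (e / (c + 1)) (divr_gt0 e0 c10).
exists [seq (c * a.1, (a.2 + b) / m) | a <- s].
  rewrite big_map/=; under eq_bigr do rewrite normrM (ger0_norm c0).
  by rewrite -mulr_sumr ler_wpM2l.
move=> x; have -> : step [seq (c * a.1, (a.2 + b) / m) | a <- s] x =
    c * step s (m * x - b).
  rewrite /step big_map mulr_sumr; apply: eq_bigr => a _ /=.
  by rewrite mulrA ler_pdivlMr// lerBlDr [x * m]mulrC.
rewrite -mulrBr normrM ger0_norm//.
have := gs (m * x - b); rewrite ler_pdivlMr//; apply: le_trans.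
by rewrite mulrC ler_wpM2l// lerDl.
Qed.

(** The increments of [g] are dominated by the masses of consecutive disjoint
    intervals, and these masses add up. *)
Lemma variation_le_measure (mu : {measure set R -> \bar R}) (t : nat -> R) g N :
  (forall k, t k <= t k.+1) ->
  (forall a b, a <= b -> (`|g b - g a|%:E <= mu `[a, b[%classic)%E) ->
  (\sum_(k < N) `|g (t k.+1) - g (t k)|%:E <= mu `[t 0%N, t N[%classic)%E.
Proof.
move=> t_nd gmu.
have t0 n : t 0 <= t n by elim: n => // n IH; rewrite (le_trans IH).
elim: N => [|N IH]; first by rewrite big_ord0 measure_ge0.
have -> : `[t 0, t N.+1[%classic = `[t 0, t N[%classic `|` `[t N, t N.+1[%classic.
  by rewrite -itv_bndbnd_setU// bnd_simp.
rewrite measureU//=; last first.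
  apply/seteqP; split => // x [] /=; rewrite !in_itv/= => /andP[_ h1] /andP[h2 _].
  by have := lt_le_trans h1 h2; rewrite ltxx.
by rewrite big_ord_recr/=; apply: leeD => //; apply: gmu.
Qed.

(** Abel summation: only the increments from the first threshold above [x] on
    contribute at [x], and they telescope. *)
Lemma step_telescope g (t : nat -> R) N k0 x : (k0 <= N)%N ->
  (forall k, (x <= t k) = (k0 <= k)%N) ->
  step [seq (g (t k) - g (t k.+1), t k) | k <- iota 0 N] x = g (t k0) - g (t N).
Proof.
move=> k0N xt; rewrite /step big_map -{1}[N]subn0 -/(index_iota 0 N).
rewrite (big_cat_nat (leq0n k0) k0N)//= big_nat big1 ?add0r; last first.
  by move=> k /andP[_ kk0]; rewrite xt leqNgt kk0 mulr0.
rewrite -[RHS]opprB -(@telescope_sumr _ k0 N (g \o t) k0N) -sumrN big_nat [RHS]big_nat.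
by apply: eq_bigr => k /andP[k0k _]; rewrite xt k0k mulr1 opprB.
Qed.

(** Sample at the points k / N.  Up to sign, the weights are the increments of
    the function over [k/N, (k+1)/N[, whose sum of absolute values is at most the total
    variation; the value of the step function at [x] is the value of the
    function at the first k / N above [x], and the Lipschitz constant of the
    polynomial controls the difference on ]0, 1].  The sampling runs one step
    past 1, where the function vanishes, so that the jump at 1 is counted. *)
Lemma cut_poly_step_approximable q (nu : {charge set R -> \bar R}) :
  is_differential (cut_poly q) nu ->
  step_approximable (fine (tv_norm nu)) (cut_poly q).
Proof.
move=> qnu e e0; have [L L0 qL] := poly_lipschitz01 q.
have [N /= NL] : exists N : nat, (0 < N)%N && (L / e <= N%:R).
  exists (Num.truncn (L / e)).+1; rewrite ltn0Sn/= ltW//.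
  exact: truncnS_gt.
case/andP: NL => N0 NL.
have NR : (0 : R) < N%:R by rewrite ltr0n.
pose t (k : nat) : R := k%:R / N%:R.
pose s := [seq (cut_poly q (t k) - cut_poly q (t k.+1), t k) | k <- iota 0 N.+1].
exists s.
  rewrite /s big_map -[X in iota _ X]subn0 -/(index_iota 0 N.+1) big_mkord.
  rewrite /tv_norm; case: cid => A [B AB] /=; case: cid => B' AB' /=.
  set mu := charge_variation _.
  rewrite -lee_fin fineK; last exact: fin_num_measure.
  rewrite -sumEFin; under eq_bigr do rewrite /= distrC.
  apply: (@le_trans _ _ (mu `[t 0, t N.+1[%classic)).
    apply: (@variation_le_measure mu).
      by move=> k; rewrite /t ler_pM2r ?invr_gt0// ler_nat.
    move=> a b ab; have := abse_charge_variation AB' (measurable_itv `[a, b[).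
    by rewrite qnu.
  by apply: le_measure; rewrite ?inE.
move=> x.
have tN1 : cut_poly q (t N.+1) = 0.
  apply: cut_poly_out; rewrite negb_and -!ltNge; apply/orP; right.
  by rewrite /t ltr_pdivlMr// mul1r ltr_nat.
(* Left of 0 every threshold counts and the increments sum to 0. *)
have [x0|x0] := lerP x 0.
  rewrite /s (@step_telescope _ _ _ 0%N)//.
    rewrite tN1 /t mul0r (@cut_poly_out _ x) ?(@cut_poly_out _ 0).
    - by rewrite !subrr normr0 ltW.
    - by rewrite ltxx.
    - by rewrite ltNge x0.
  by move=> k; rewrite leq0n (le_trans x0)// divr_ge0.
(* Otherwise, k0 is the first index whose threshold is at least x. *)
have tle k : (x <= t k) = (x * N%:R <= k%:R) by rewrite ler_pdivlMr.
have tE : exists k, x <= t k.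
  exists (Num.truncn (x * N%:R)).+1; rewrite tle ltW//; exact: truncnS_gt.
have xk0 k : (x <= t k) = (ex_minn tE <= k)%N.
  case: ex_minnP => k0 xk0 k0min; apply/idP/idP => [/k0min//|k0k].
  by rewrite (le_trans xk0)// ler_pM2r ?invr_gt0// ler_nat.
move: (ex_minn tE) xk0 => k0 xk0.
have [k0N|Nk0] := leqP k0 N.+1; last first.
  have xN : ~~ (x <= t N.+1) by rewrite xk0 -ltnNge.
  rewrite /s /step big_map big_seq big1 ?subr0; last first.
    move=> k; rewrite mem_iota/= add0n => kN.
    by rewrite xk0 leqNgt (ltn_trans kN)// mulr0.
  rewrite cut_poly_out; first by rewrite normr0 ltW.
  apply: contra xN => /andP[_ x1].
  by rewrite tle -natr1 (le_trans (ler_piMl _ x1))// lerDl.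
rewrite /s (step_telescope _ k0N xk0) tN1 subr0.
have k00 : (0 < k0)%N.
  by rewrite ltnNge -xk0 /t mul0r -ltNge.
have tk0 : x <= t k0 by rewrite xk0.
have k0x : t k0.-1 < x by rewrite ltNge xk0 -ltnNge prednK.
have tk00 : 0 < t k0 by exact: lt_le_trans tk0.
have [tk01|tk01] := lerP (t k0) 1.
  have x1 : x <= 1 by exact: le_trans tk01.
  rewrite !cut_polyE ?x0 ?x1 ?tk00 ?tk01//.
  rewrite (le_trans (qL _ _ _ _)) ?(ltW x0) ?x1 ?(ltW tk00) ?tk01//.
  have : `|x - t k0| <= N%:R^-1.
    rewrite distrC ger0_norm ?subr_ge0// lerBlDr -lerBlDl.
    have -> : t k0 - N%:R^-1 = t k0.-1.
      rewrite /t -[in LHS](prednK k00) -natr1 mulrDl mul1r; ring.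
    exact: ltW.
  move=> /(ler_wpM2l L0) /le_trans; apply.
  by rewrite ler_pdivrMr// -ler_pdivrMl// mulrC.
have x1 : 1 < x.
  apply: le_lt_trans k0x; rewrite /t ler_pdivlMr// mul1r ler_nat.
  by move: tk01; rewrite /t ltr_pdivlMr// mul1r ltr_nat -{1}(prednK k00) ltnS.
rewrite (@cut_poly_out _ x) ?(@cut_poly_out _ (t k0)).
- by rewrite subrr normr0 ltW.
- by rewrite negb_and -!ltNge tk01 orbT.
- by rewrite negb_and -!ltNge x1 orbT.
Qed.
End cut_poly.

(** * Conditional distribution functions *)

Section covariance.
Context d (T : measurableType d) (R : realType) (P : probability T R).

Lemma bounded_mfun_comp (X : {RV P >-> R}) (g : R -> R) :
  measurable_fun setT g -> (exists M, forall x, `|g x| <= M) ->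
  bounded_mfun (fun w => g (X w)).
Proof.
move=> mg [M gM]; split; last by exists M.
exact: (measurableT_comp mg).
Qed.

Lemma measurable_le_cst (t : R) : measurable_fun setT (fun x : R => (x <= t)%R%:R : R).
Proof.
rewrite (_ : (fun _ => _) = \1_(`]-oo, t]%classic : set R)).
  exact: measurable_indic.
by apply/funext => x; rewrite indicE mem_setE in_itv.
Qed.

Lemma bounded_mfun_le (X : {RV P >-> R}) (t : R) :
  bounded_mfun (fun w => (X w <= t)%R%:R : R).
Proof.
apply: (bounded_mfun_comp X (measurable_le_cst t)).
by exists 1 => x; case: (x <= t)%R => /=; rewrite ?normr1 ?normr0.
Qed.

Lemma measurable_step (s : seq (R * R)) : measurable_fun setT (step s).
Proof.
rewrite /step; elim: s => [|a s IH].
  by under eq_fun do rewrite big_nil; exact: measurable_cst.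
under eq_fun do rewrite big_cons; apply: measurable_funD => //.
by apply: measurable_funM => //; exact: measurable_le_cst.
Qed.

Lemma bounded_step (s : seq (R * R)) : exists M, forall x, `|step s x| <= M.
Proof.
exists (\sum_(a <- s) `|a.1|) => x.
rewrite (le_trans (ler_norm_sum _ _ _))// ler_sum// => a _; rewrite normrM.
by case: (x <= a.2)%R; rewrite /= ?normr1 ?mulr1// normr0 mulr0.
Qed.

Lemma bounded_mfun_step (X : {RV P >-> R}) (s : seq (R * R)) :
  bounded_mfun (fun w => step s (X w)).
Proof. exact: bounded_mfun_comp (measurable_step s) (bounded_step s). Qed.

Lemma indic_preimage_le (X : T -> R) (t : R) w :
  (X w <= t)%R%:R = \1_(X @^-1` `]-oo, t]) w :> R.
Proof.
rewrite indicE; congr ((nat_of_bool _)%:R).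
by apply/idP/idP; rewrite inE/= in_itv/=.
Qed.

Lemma mean_indic_le (X : {RV P >-> R}) (t : R) :
  \int[P]_w ((X w <= t)%R%:R) = fine (distribution P X `]-oo, t]).
Proof.
rewrite /Rintegral; congr fine.
under eq_integral do rewrite indic_preimage_le.
rewrite integral_indic// ?setIT// -[X in measurable X]setTI.
exact: measurable_funP.
Qed.

End covariance.

Section conditioning.
Context d (T : measurableType d) (R : realType) (P : probability T R).
Context (Y : int -> {RV P >-> R}) (kappa : R.-pker (past Y 0) ~> R).

(** [past Y 0] carries another sigma-algebra on the same points as [T]; a
    set measurable for the former is measurable for the latter. *)
Lemma past_measurable (A : set T) : <<s past_events Y 0 >> A -> measurable A.
Proof.
apply: smallest_sub; first exact: sigma_algebra_measurable.
by move=> _ [i _ [B mB <-]]; exact: measurable_funP.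
Qed.

Definition cond_cdf (t : R) (w : T) : R := fine (kappa w `]-oo, t]%classic).

Let kappa_le1 t w : (kappa w `]-oo, t]%classic <= 1)%E.
Proof.
by rewrite -(@prob_kernel _ _ _ _ _ kappa w); apply: le_measure; rewrite ?inE.
Qed.

Lemma cond_cdfE t w : kappa w `]-oo, t]%classic = (cond_cdf t w)%:E.
Proof.
by rewrite /cond_cdf fineK// ge0_fin_numE// (le_lt_trans (kappa_le1 _ _))// ltry.
Qed.

Lemma cond_cdf_ge0 t w : 0 <= cond_cdf t w.
Proof. by rewrite /cond_cdf fine_ge0. Qed.

Lemma cond_cdf_le1 t w : cond_cdf t w <= 1.
Proof. by rewrite -lee_fin -cond_cdfE. Qed.

Lemma bounded_mfun_cond_cdf t : bounded_mfun (cond_cdf t).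
Proof.
split; last by exists 1 => w; rewrite ger0_norm ?cond_cdf_ge0// cond_cdf_le1.
suff : measurable_fun [set: T] (fun w => kappa w `]-oo, t]%classic).
  by move=> mk; apply: measurableT_comp mk.
move=> _ B mB; rewrite setTI; apply: past_measurable.
have := @measurable_kernel _ _ _ _ _ kappa `]-oo, t]%classic (measurable_itv _).
by move=> /(_ measurableT B mB); rewrite setTI.
Qed.

Context (X : {RV P >-> R}) (X_cond : is_cond_distribution X kappa).

(** The defining property of the conditional law, for the past event
    Y_0 <= s. *)
Lemma mean_cond_indic (s t : R) :
  \int[P]_w ((Y 0 w <= s)%R%:R * (X w <= t)%R%:R) =
  \int[P]_w ((Y 0 w <= s)%R%:R * cond_cdf t w).
Proof.
pose A := Y 0 @^-1` `]-oo, s].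
have FA : <<s past_events Y 0 >> A.
  apply: sub_sigma_algebra; exists 0 => //=; exists `]-oo, s]%classic => //.
  by rewrite setTI.
have mA := past_measurable FA.
have AE w : (Y 0 w <= s)%R%:R = \1_A w :> R by exact: indic_preimage_le.
have mX : measurable (X @^-1` `]-oo, t]).
  by rewrite -[X in measurable X]setTI; exact: measurable_funP.
rewrite /Rintegral; congr fine.
transitivity (P (A `&` X @^-1` `]-oo, t])).
  under eq_integral do rewrite AE indic_preimage_le
    -[_ * _]/((\1_A \* \1_(X @^-1` `]-oo, t])) _) -indicI.
  by rewrite integral_indic ?setIT//; exact: measurableI.
rewrite -X_cond// [LHS]integral_mkcond; apply: eq_integral => w _.
rewrite patchE AE indicE; case: (w \in A); last by rewrite mul0r.
by rewrite mul1r cond_cdfE.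
Qed.

(** Both sides are linear in [g] and continuous for the uniform norm, so it
    suffices that they agree on indicators of half-lines. *)
Lemma mean_cond_cdf (V : R) (g : R -> R) (t : R) : measurable_fun setT g ->
  (exists M, forall x, `|g x| <= M) -> step_approximable V g ->
  \int[P]_w (g (Y 0 w) * (X w <= t)%R%:R) =
  \int[P]_w (g (Y 0 w) * cond_cdf t w).
Proof.
move=> mg gb gV; apply/eqP; rewrite -subr_eq0 -normr_le0; apply/ler_addgt0Pr => e e0.
rewrite add0r.
have [s _ gs] := gV (e / 2) (divr_gt0 e0 (ltr0n _ 2)).
have bg := bounded_mfun_comp (Y 0) mg gb.
have bs := bounded_mfun_step (Y 0) s.
have bX := bounded_mfun_le X t; have bK := bounded_mfun_cond_cdf t.
have h (U : T -> R) : bounded_mfun U -> (forall w, 0 <= U w <= 1) ->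
    `|\int[P]_w (g (Y 0 w) * U w) - \int[P]_w (step s (Y 0 w) * U w)| <= e / 2.
  move=> bU U01; apply: mean_dist; [exact: bounded_mfunM..|] => w.
  rewrite -mulrBl normrM; have /andP[U0 U1] := U01 w.
  by rewrite (ger0_norm U0) -[leRHS]mulr1 ler_pM.
have stepE (U : T -> R) : bounded_mfun U -> \int[P]_w (step s (Y 0 w) * U w) =
    \sum_(a <- s) a.1 * \int[P]_w ((Y 0 w <= a.2)%R%:R * U w).
  move=> bU; have ba a := bounded_mfunM (bounded_mfun_le (Y 0) a) bU.
  under eq_Rintegral do rewrite /step mulr_suml.
  rewrite mean_sum; last first.
    move=> a; do 2 apply: bounded_mfunM => //; first exact: bounded_mfun_cst.
    exact: bounded_mfun_le.
  apply: eq_bigr => a _; rewrite -meanZl//.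
  by under eq_Rintegral do rewrite -mulrA.
pose Z := \int[P]_w (step s (Y 0 w) * cond_cdf t w).
have ZE : \int[P]_w (step s (Y 0 w) * (X w <= t)%R%:R) = Z.
  by rewrite /Z !stepE//; apply: eq_bigr => a _; rewrite mean_cond_indic.
rewrite (le_trans (ler_distD Z _ _))// [leRHS]splitr lerD//.
  by rewrite -ZE; apply: h => // w; case: (X w <= t)%R; rewrite /= ?lexx ler01.
rewrite distrC; apply: h => // w.
by rewrite cond_cdf_ge0 cond_cdf_le1.
Qed.

End conditioning.

(** * Covariance bound in terms of the dependence coefficient *)

Section covariance_bound.
Context d (T : measurableType d) (R : realType) (P : probability T R).
Context (Y : int -> {RV P >-> R}) (kappa : R.-pker (past Y 0) ~> R).

Let cdf0 t : R := fine (distribution P (Y 0) `]-oo, t]).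

Lemma b_coefE (w : T) : b_coef kappa w =
  ereal_sup [set `|cond_cdf kappa t w - cdf0 t|%:E | t in [set: R]].
Proof.
congr ereal_sup; apply: eq_imagel => t _.
rewrite !integral_indic// !setIT cond_cdfE.
by rewrite -abse_EFin EFinB [(cdf0 t)%:E]fineK//; exact: fin_num_measure.
Qed.

Lemma b_coef_ge (w : T) t :
  (`|cond_cdf kappa t w - cdf0 t|%:E <= b_coef kappa w)%E.
Proof. by rewrite b_coefE; apply: ereal_sup_ubound; exists t. Qed.

Lemma b_coef_ge0 (w : T) : (0 <= b_coef kappa w)%E.
Proof. by apply: le_trans (b_coef_ge w 0); rewrite lee_fin. Qed.

Lemma b_coef_le1 (w : T) : (b_coef kappa w <= 1)%E.
Proof.
rewrite b_coefE; apply: ge_ereal_sup => _ [t _ <-]; rewrite lee_fin.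
have F0 : 0 <= cdf0 t by rewrite fine_ge0.
have F1 : cdf0 t <= 1.
  rewrite -lee_fin fineK; last exact: fin_num_measure.
  exact: probability_le1.
rewrite ler_norml; apply/andP; split.
  by rewrite lerBrDr addrC (le_trans _ (cond_cdf_ge0 _ _ _))// subr_le0.
by rewrite lerBlDr (le_trans (cond_cdf_le1 _ _ _))// lerDl.
Qed.

(** The coefficient beta_{1,Y}(k) as a real number: it is at most 1. *)
Definition beta_coef : R := fine (\int[P]_w b_coef kappa w)%E.

Lemma beta_coefE : (\int[P]_w b_coef kappa w)%E = beta_coef%:E.
Proof.
rewrite /beta_coef fineK// ge0_fin_numE; last first.
  by apply: integral_ge0 => w _; exact: b_coef_ge0.
apply: (@le_lt_trans _ _ (\int[P]_w 1)%E).
  by apply: ge0_le_integral_nomeas => w _; [exact: b_coef_ge0|exact: b_coef_le1].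
by rewrite integral_cst// mul1e fin_num_fun_lty//; exact: fin_num_measure.
Qed.

Lemma beta_coef_ge0 : 0 <= beta_coef.
Proof. by rewrite fine_ge0// integral_ge0// => w _; exact: b_coef_ge0. Qed.

Lemma mean_le_beta_coef (X : T -> R) c : 0 <= c -> bounded_mfun X ->
  (forall w, 0 <= X w) -> (forall w, ((X w)%:E <= c%:E * b_coef kappa w)%E) ->
  \int[P]_w X w <= c * beta_coef.
Proof.
move=> c0 bX X0 Xb; move: c0; rewrite le_eqVlt => /predU1P[c0|c0].
  rewrite -c0 mul0r -[leRHS](mean_cst P 0); apply: le_mean => //.
    exact: bounded_mfun_cst.
  by move=> w; have := Xb w; rewrite -c0 mul0e lee_fin.
rewrite -ler_pdivrMl// -meanZl// -lee_fin -beta_coefE.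
rewrite -bounded_mfun_integral; last exact: bounded_mfunZ.
apply: ge0_le_integral_nomeas => w _; first by rewrite lee_fin mulr_ge0// invr_ge0 ltW.
by rewrite EFinM lee_pdivrMl.
Qed.

Context (X : {RV P >-> R}) (X_cond : is_cond_distribution X kappa).
Hypothesis X_law : forall t,
  distribution P X `]-oo, t] = distribution P (Y 0) `]-oo, t].

(** Conditioning on the past replaces [g j (X w)] by its conditional mean.  As
    [g j] is a mixture of half-line indicators of total mass at most [V], this
    conditional mean differs from the mean by at most [V] times [b_coef].  The
    bound on the sum over [j] comes from the past factor alone: the sum of the
    |g j (Y_0)| is at most [S] pointwise, so that summing over the family does
    not multiply the bound by its size. *)
Lemma sum_cov_le (J : seq nat) (g : nat -> R -> R) (S V M : R) :
  (forall j, measurable_fun setT (g j)) ->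
  (forall j x, `|g j x| <= M) ->
  (forall j, step_approximable V (g j)) ->
  (forall x, \sum_(j <- J) `|g j x| <= S) ->
  \sum_(j <- J) `|\int[P]_w (g j (Y 0 w) * g j (X w)) -
                  (\int[P]_w g j (Y 0 w)) * (\int[P]_w g j (X w))|
  <= S * V * beta_coef.
Proof.
move=> mg gM gV gS.
have S0 : 0 <= S by rewrite (le_trans _ (gS 0))// sumr_ge0.
have V0 : 0 <= V by have [s sV _] := gV 0%N 1 ltr01; rewrite (le_trans _ sV)// sumr_ge0.
have M0 : 0 <= M by rewrite (le_trans _ (gM 0%N 0)).
have bgY j (Z : {RV P >-> R}) : bounded_mfun (fun w => g j (Z w)).
  by apply: bounded_mfun_comp => //; exists M => x.
apply/ler_addgt0Pr => e0 e00.
(* Each term costs at most 2 M e when g j is replaced by a step function. *)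
pose e := e0 / ((size J)%:R * (M * 2) + 1).
have K1 : 0 < (size J)%:R * (M * 2) + 1 :> R.
  by rewrite ltr_wpDl// mulr_ge0// mulr_ge0.
have e_gt0 : 0 < e by rewrite divr_gt0.
have /choice[s sP] : forall j, exists s : seq (R * R),
    \sum_(a <- s) `|a.1| <= V /\ forall x, `|g j x - step s x| <= e.
  by move=> j; have [s sV sg] := gV j e e_gt0; exists s.
(* D j is the conditional mean of the centered step function. *)
pose D j w := \sum_(a <- s j) a.1 * (cond_cdf kappa a.2 w - cdf0 a.2).
have bcdf t : bounded_mfun (fun w => cond_cdf kappa t w - cdf0 t).
  apply: bounded_mfunB; [exact: bounded_mfun_cond_cdf|exact: bounded_mfun_cst].
have bD j : bounded_mfun (D j).
  by apply: bounded_mfun_sum => a; exact: bounded_mfunZ.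
have bXt t : bounded_mfun (fun w => (X w <= t)%R%:R - cdf0 t : R).
  by apply: bounded_mfunB; [exact: bounded_mfun_le|exact: bounded_mfun_cst].
(* For a step function, conditioning acts on each half-line separately. *)
have stepE j :
    \int[P]_w (g j (Y 0 w) * (step (s j) (X w) - \int[P]_w step (s j) (X w))) =
    \int[P]_w (g j (Y 0 w) * D j w).
  have -> : \int[P]_w step (s j) (X w) = \sum_(a <- s j) a.1 * cdf0 a.2.
    rewrite mean_sum; last by move=> a; apply: bounded_mfunZ; exact: bounded_mfun_le.
    apply: eq_bigr => a _; rewrite meanZl; last exact: bounded_mfun_le.
    by rewrite mean_indic_le X_law.
  transitivity (\sum_(a <- s j) a.1 *
    \int[P]_w (g j (Y 0 w) * ((X w <= a.2)%R%:R - cdf0 a.2))).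
    under eq_Rintegral do rewrite /step -sumrB mulr_sumr.
    under eq_Rintegral do under eq_bigr do rewrite -mulrBr mulrCA.
    rewrite mean_sum; last by move=> a; apply: bounded_mfunZ; exact: bounded_mfunM.
    by apply: eq_bigr => a _; rewrite meanZl//; exact: bounded_mfunM.
  transitivity (\sum_(a <- s j) a.1 *
    \int[P]_w (g j (Y 0 w) * (cond_cdf kappa a.2 w - cdf0 a.2))).
    apply: eq_bigr => a _; congr (_ * _).
    under eq_Rintegral do rewrite mulrBr.
    under [RHS]eq_Rintegral do rewrite mulrBr.
    have b1 : bounded_mfun (fun w => g j (Y 0 w) * cdf0 a.2).
      by apply: bounded_mfunM => //; exact: bounded_mfun_cst.
    rewrite !meanB//.
    - by rewrite (mean_cond_cdf X_cond _ _ _ (gV j)) //; exists M.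
    - by apply: bounded_mfunM => //; exact: bounded_mfun_cond_cdf.
    - by apply: bounded_mfunM => //; exact: bounded_mfun_le.
  under [RHS]eq_Rintegral do rewrite /D mulr_sumr.
  under [RHS]eq_Rintegral do under eq_bigr do rewrite mulrCA.
  rewrite mean_sum; last by move=> a; apply: bounded_mfunZ; exact: bounded_mfunM.
  by apply: eq_bigr => a _; rewrite meanZl//; exact: bounded_mfunM.
have bs j := bounded_mfun_step X (s j).
have covE j : `|\int[P]_w (g j (Y 0 w) * g j (X w)) -
      (\int[P]_w g j (Y 0 w)) * (\int[P]_w g j (X w))| <=
    \int[P]_w (`|g j (Y 0 w)| * `|D j w|) + M * 2 * e.
  have bc c : bounded_mfun (fun _ : T => c : R) by exact: bounded_mfun_cst.
  have -> : \int[P]_w (g j (Y 0 w) * g j (X w)) -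
      (\int[P]_w g j (Y 0 w)) * (\int[P]_w g j (X w)) =
      \int[P]_w (g j (Y 0 w) * (g j (X w) - \int[P]_w g j (X w))).
    under [RHS]eq_Rintegral do rewrite mulrBr mulrC [_ * (\int[P]__ _)]mulrC.
    rewrite meanB ?meanZl//; [|exact: bounded_mfunM|exact: bounded_mfunM].
    by under eq_Rintegral do rewrite mulrC; rewrite [_ * (\int[P]__ _)]mulrC.
  rewrite -[X in `|X|](subrK (\int[P]_w (g j (Y 0 w) * D j w))) addrC.
  rewrite (le_trans (ler_normD _ _))// lerD//.
    rewrite (le_trans (mean_norm P (bounded_mfunM _ _)))//.
    by under eq_Rintegral do rewrite normrM.
  rewrite -stepE; apply: mean_dist.
  - by apply: bounded_mfunM => //; exact: bounded_mfunB.
  - by apply: bounded_mfunM => //; exact: bounded_mfunB.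
  move=> w; rewrite -mulrBr normrM -mulrA ler_pM//.
  have -> : 2 * e = e + e by ring.
  rewrite (_ : _ - _ = (g j (X w) - step (s j) (X w)) -
    (\int[P]_w g j (X w) - \int[P]_w step (s j) (X w))); last ring.
  rewrite (le_trans (ler_normB _ _))// lerD//; first exact: (sP j).2.
  by apply: mean_dist => // u; exact: (sP j).2.
apply: (le_trans (ler_sum _ (fun j _ => covE j))).
rewrite big_split/= big_const_seq count_predT iter_addr addr0 lerD//; last first.
  rewrite -[_ *+ size J]mulr_natl mulrA /e [leLHS]mulrA ler_pdivrMr// [leRHS]mulrC.
  by rewrite ler_wpM2r ?(ltW e00)// lerDl.
rewrite -mean_sum; last by move=> j; apply: bounded_mfunM; exact: bounded_mfun_norm.
apply: mean_le_beta_coef.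
- exact: mulr_ge0.
- by apply: bounded_mfun_sum => j; apply: bounded_mfunM; exact: bounded_mfun_norm.
- by move=> w; apply: sumr_ge0 => j _; exact: mulr_ge0.
move=> w; have bfin : b_coef kappa w \is a fin_num.
  by rewrite ge0_fin_numE ?b_coef_ge0// (le_lt_trans (b_coef_le1 w))// ltry.
rewrite -(fineK bfin) -EFinM lee_fin.
have Dle j : `|D j w| <= V * fine (b_coef kappa w).
  rewrite (le_trans (ler_norm_sum _ _ _))//.
  apply: (@le_trans _ _ (\sum_(a <- s j) `|a.1| * fine (b_coef kappa w))).
    apply: ler_sum => a _; rewrite normrM ler_wpM2l//.
    by rewrite -lee_fin fineK// b_coef_ge.
  by rewrite -mulr_suml ler_wpM2r ?fine_ge0 ?b_coef_ge0//; exact: (sP j).1.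
apply: (@le_trans _ _ (\sum_(j <- J) `|g j (Y 0 w)| * (V * fine (b_coef kappa w)))).
  by apply: ler_sum => j _; rewrite ler_wpM2l.
by rewrite -mulr_suml -[leRHS]mulrA ler_wpM2r// mulr_ge0// fine_ge0// b_coef_ge0.
Qed.

End covariance_bound.

(** * Stationarity and the variance of averages *)

Section stationarity.
Context d (T : measurableType d) (R : realType) (P : probability T R).

Lemma mean_eq_law (X Z : {RV P >-> R}) (g : R -> R) :
  (forall B, measurable B -> distribution P X B = distribution P Z B) ->
  measurable_fun setT g -> (exists M, forall x, `|g x| <= M) ->
  \int[P]_w g (X w) = \int[P]_w g (Z w).
Proof.
move=> XZ mg gb; rewrite /Rintegral; congr fine.
have mEg : measurable_fun setT (EFin \o g) by exact/measurable_EFinP.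
have bg (W : {RV P >-> R}) : P.-integrable setT ((EFin \o g) \o W).
  exact: (bounded_mfun_integrable P (bounded_mfun_comp W mg gb)).
rewrite -(integral_distribution mEg (bg X)) -(integral_distribution mEg (bg Z)).
by apply: eq_measure_integral => B mB _; exact: XZ.
Qed.

Context (Y : int -> {RV P >-> R}) (Y_stationary : strictly_stationary Y).

(** Both means are integrals of the same function on pairs against the laws of
    (Y_k, Y_{k+h}) and (Y_0, Y_h), which coincide. *)
Lemma mean_pair_shift (g : R -> R) (k h : nat) :
  measurable_fun setT g -> (exists M, forall x, `|g x| <= M) ->
  \int[P]_w (g (Y k%:Z w) * g (Y (k + h)%:Z w)) =
  \int[P]_w (g (Y 0 w) * g (Y h%:Z w)).
Proof.
move=> mg [M gM].
pose t (i : 'I_2) : int := if i == ord0 then 0 else h%:Z.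
pose G (u : 2.-tuple R) := g (tnth u ord0) * g (tnth u ord_max).
have mG : measurable_fun setT (EFin \o G).
  apply/measurable_EFinP; apply: measurable_funM.
    exact: (measurableT_comp mg (measurable_tnth _)).
  exact: (measurableT_comp mg (measurable_tnth _)).
pose Yt (s : 'I_2 -> int) (w : T) := [tuple Y (s i) w | i < 2].
have mYt s : measurable_fun setT (Yt s).
  apply/measurable_fun_tnthP => i; rewrite (_ : _ \o _ = Y (s i)) //.
  by apply/funext => w /=; rewrite tnth_mktuple.
have GYt s : (EFin \o G) \o Yt s = fun w => (g (Y (s ord0) w) * g (Y (s ord_max) w))%:E.
  by apply/funext => w; rewrite /G /= !tnth_mktuple.
have iG s : P.-integrable (Yt s @^-1` setT) ((EFin \o G) \o Yt s).
  rewrite preimage_setT GYt; apply: (bounded_mfun_integrable P).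
  by apply: bounded_mfunM; apply: bounded_mfun_comp => //; exists M.
have E s : (\int[P]_w (g (Y (s ord0) w) * g (Y (s ord_max) w))%:E =
    \int[pushforward P (Yt s)]_u (G u)%:E)%E.
  by rewrite (integral_pushforward (mYt s) mG (iG s))// preimage_setT GYt.
rewrite /Rintegral; congr fine.
have := E (fun i => t i + k%:Z); rewrite /t/= add0r -PoszD addnC => ->.
have := E t; rewrite /t/= => ->.
by apply: eq_measure_integral => B mB _; exact: Y_stationary.
Qed.

End stationarity.

Section variance.
Context d (T : measurableType d) (R : realType) (P : probability T R).

Lemma mean_centered (X Z : T -> R) : bounded_mfun X -> bounded_mfun Z ->
  \int[P]_w ((X w - \int[P]_w X w) * (Z w - \int[P]_w Z w)) =
  \int[P]_w (X w * Z w) - (\int[P]_w X w) * (\int[P]_w Z w).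
Proof.
move=> bX bZ; set x := \int[P]_w X w; set z := \int[P]_w Z w.
under eq_Rintegral => w _.
  rewrite (_ : _ * _ = X w * Z w - (z * X w + x * Z w - x * z)); last by ring.
  over.
have bc (c : R) : bounded_mfun (fun _ : T => c) by exact: bounded_mfun_cst.
have bxz : bounded_mfun (fun w => z * X w + x * Z w).
  by apply: bounded_mfunD; exact: bounded_mfunZ.
rewrite meanB; [|exact: bounded_mfunM|exact: bounded_mfunB].
rewrite meanB// meanD; [|exact: bounded_mfunZ..].
by rewrite !meanZl// mean_cst -/x -/z; ring.
Qed.

(** Each lag h is the distance from [k] to at most two indices, k - h and
    k + h. *)
Lemma sum_dist_le (c : nat -> R) (n k : nat) : (forall h, 0 <= c h) ->
  (0 < k <= n)%N ->
  \sum_(1 <= l < n.+1) c ((k - l) + (l - k))%N <= 2 * \sum_(0 <= h < n.+1) c h.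
Proof.
move=> c0 kn.
have uniq_le (a : nat) : \sum_(1 <= l < n.+1) (l == a)%:R <= 1 :> R.
  rewrite -natr_sum lern1.
  under eq_bigr => l _ do rewrite -[nat_of_bool _]/(if l == a then 1%N else 0%N).
  by rewrite -big_mkcond/= sum1_count count_uniq_mem ?iota_uniq// leq_b1.
apply: (@le_trans _ _ (\sum_(1 <= l < n.+1) \sum_(0 <= h < n.+1)
    ((l == k + h)%N%:R + (l == k - h)%N%:R) * c h)).
  rewrite big_nat [leRHS]big_nat; apply: ler_sum => l /andP[l0 ln].
  have hn : ((k - l) + (l - k) < n.+1)%N by lia.
  rewrite (bigD1_seq ((k - l) + (l - k))%N) ?mem_index_iota ?iota_uniq//=.
  rewrite -[leLHS]addr0 lerD//; last first.
    by apply: sumr_ge0 => h _; rewrite mulr_ge0// addr_ge0.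
  rewrite ler_peMl//; have [lk|kl] := leqP l k.
    by rewrite (_ : (l == k - _)%N = true) ?lerDr//; lia.
  by rewrite (_ : (l == k + _)%N = true) ?lerDl//; lia.
rewrite exchange_big/= mulr_sumr; apply: ler_sum => h _.
rewrite -mulr_suml ler_wpM2r// big_split/= (_ : 2 = 1 + 1); last by ring.
by rewrite lerD// uniq_le.
Qed.

(** The variance is n^-2 times the sum of the covariances over all pairs of
    indices, and each lag occurs at most 2 n times. *)
Lemma variance_average_le (X : T -> R) (Z : nat -> T -> R) (c : nat -> R) n :
  (0 < n)%N -> (forall k, bounded_mfun (Z k)) -> (forall h, 0 <= c h) ->
  (forall k h, \int[P]_w (Z k w * Z (k + h)%N w) -
     (\int[P]_w Z k w) * (\int[P]_w Z (k + h)%N w) <= c h) ->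
  (forall w, X w = n%:R^-1 * \sum_(1 <= k < n.+1) Z k w) ->
  \int[P]_w ((X w - \int[P]_w X w) ^+ 2) <= 2 / n%:R * \sum_(0 <= h < n.+1) c h.
Proof.
move=> n0 bZ c0 cov XZ.
pose W k w := Z k w - \int[P]_w Z k w.
have bW k : bounded_mfun (W k) by apply: bounded_mfunB => //; exact: bounded_mfun_cst.
have XE w : X w - \int[P]_w X w = n%:R^-1 * \sum_(1 <= k < n.+1) W k w.
  under eq_Rintegral do rewrite XZ.
  rewrite XZ meanZl; last exact: bounded_mfun_sum.
  by rewrite mean_sum// -mulrBr -sumrB.
under eq_Rintegral do rewrite XE exprMn expr2 [X in _ * X]expr2 big_distrlr/=.
rewrite meanZl; last first.
  by do 2 (apply: bounded_mfun_sum => ?); exact: bounded_mfunM.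
rewrite mean_sum; last by move=> k; apply: bounded_mfun_sum => l; exact: bounded_mfunM.
have sumWW k : \int[P]_w (\sum_(1 <= l < n.+1) W k w * W l w) =
    \sum_(1 <= l < n.+1) \int[P]_w (W k w * W l w).
  by rewrite mean_sum// => l; exact: bounded_mfunM.
under eq_bigr do rewrite sumWW.
have covW k l : \int[P]_w (W k w * W l w) <= c ((k - l) + (l - k))%N.
  rewrite mean_centered//; have [kl|lk] := leqP k l.
    have := cov k (l - k)%N; rewrite subnKC// => /le_trans; apply.
    by rewrite (_ : (k - l = 0)%N)//; lia.
  have := cov l (k - l)%N; rewrite subnKC ?(ltnW lk)// => h.
  rewrite (_ : (l - k = 0)%N) ?addn0; last lia.
  by rewrite mulrC; under eq_Rintegral do rewrite mulrC.
have nR : (0 : R) < n%:R by rewrite ltr0n.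
apply: (@le_trans _ _ (n%:R^-1 * n%:R^-1 *
    \sum_(1 <= k < n.+1) 2 * \sum_(0 <= h < n.+1) c h)).
  rewrite ler_wpM2l ?mulr_ge0 ?invr_ge0//.
  rewrite big_nat [leRHS]big_nat; apply: ler_sum => k kn.
  by apply: le_trans (sum_dist_le c0 kn); apply: ler_sum.
rewrite big_const_nat iter_addr addr0 subSS subn0 -[(2 * _) *+ n]mulr_natl.
rewrite le_eqVlt; apply/orP; left; apply/eqP.
by field; rewrite gt_eqF.
Qed.

End variance.

(** * Orthonormality of the piecewise polynomial family *)

Section cells.
Context (R : realType).
Implicit Types (y x : R) (F : nat -> R).

(** With y = m x, this says that x lies in the [j]-th interval of the regular
    partition of ]0, 1] into m pieces. *)
Definition in_cell y (j : nat) := 0 < y - (j%:R - 1) <= 1.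

Lemma in_cell_inj y j k : in_cell y j -> in_cell y k -> j = k.
Proof.
move=> /andP[j1 j2] /andP[k1 k2]; apply/eqP.
rewrite eqn_leq -[(j <= k)%N]ltnS -[(k <= j)%N]ltnS.
by rewrite -!(ltr_nat R) -!natr1; apply/andP; split; lra.
Qed.

(** The cells being disjoint, a sum of functions supported on distinct cells
    has at most one nonzero term.  The surviving index is uniform in [F], so
    that sums of different families can be compared term by term. *)
Lemma sum_in_cell y (J : seq nat) : uniq J ->
  (forall F, (forall j, ~~ in_cell y j -> F j = 0) -> \sum_(j <- J) F j = 0) \/
  exists k, forall F, (forall j, ~~ in_cell y j -> F j = 0) -> \sum_(j <- J) F j = F k.
Proof.
move=> uJ; have [/hasP[k kJ ky]|noJ] := boolP (has (in_cell y) J).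
  right; exists k => F F0; rewrite (bigD1_seq k)//= big1 ?addr0// => j jk.
  by apply: F0; apply: contra jk => jy; rewrite (in_cell_inj jy ky).
left=> F F0; rewrite big_seq big1// => j jJ; apply: F0.
by apply: contra noJ => jy; apply/hasP; exists j.
Qed.

End cells.

Section phi_family.
Context (R : realType) (r : nat) (Q : 'I_r.+1 -> {poly R}).
Implicit Types (m : nat) (i : 'I_r.+1).

Lemma measurable_phi m i j : measurable_fun setT (phi Q m i j).
Proof.
apply: measurable_funM; first exact: measurable_cst.
apply: (measurableT_comp (measurable_cut_poly (Q i))).
apply: measurable_funB; last exact: measurable_cst.
by apply: measurable_funM; [exact: measurable_cst|exact: measurable_id].
Qed.

Lemma phi_step_approximable m i j (nu : {charge set R -> \bar R}) : (0 < m)%N ->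
  is_differential (cut_poly (Q i)) nu ->
  step_approximable (Num.sqrt m%:R * fine (tv_norm nu)) (phi Q m i j).
Proof.
move=> m0 dQ; apply: step_approximable_affine; rewrite ?ltr0n ?sqrtr_ge0//.
exact: cut_poly_step_approximable.
Qed.

Lemma phi_out m i j x : ~~ in_cell (m%:R * x) j -> phi Q m i j x = 0.
Proof. by move=> xj; rewrite /phi cut_poly_out// mulr0. Qed.

Lemma phi_le m i j x S : (forall x, `|cut_poly (Q i) x| <= S) ->
  `|phi Q m i j x| <= Num.sqrt m%:R * S.
Proof. by move=> QS; rewrite normrM ger0_norm ?sqrtr_ge0// ler_wpM2l ?sqrtr_ge0. Qed.

Lemma sum_phi_le m i x S (J : seq nat) : uniq J ->
  (forall x, `|cut_poly (Q i) x| <= S) ->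
  \sum_(j <- J) `|phi Q m i j x| <= Num.sqrt m%:R * S.
Proof.
move=> uJ QS; have S0 : 0 <= S by rewrite (le_trans _ (QS 0)).
have phi0 j : ~~ in_cell (m%:R * x) j -> `|phi Q m i j x| = 0.
  by move=> /phi_out ->; rewrite normr0.
case: (sum_in_cell (m%:R * x) uJ) => [->//|[k -> //]]; last exact: phi_le.
by rewrite mulr_ge0 ?sqrtr_ge0.
Qed.

(** Change of variables by the increasing affine map of the [j]-th interval of
    the partition onto the unit interval. *)
Lemma integral_cell m j (q : {poly R}) : (0 < j <= m)%N ->
  (\int[lebesgue_measure]_(x in `[0%R, 1%R])
     (m%:R * cut_poly q (m%:R * x - (j%:R - 1)))%:E =
   \int[lebesgue_measure]_(x in `[0%R, 1%R]) q.[x]%:E)%E.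
Proof.
move=> jm; have mR : (0 : R) < m%:R by rewrite ltr0n; lia.
have j1 : (1 : R) <= j%:R by rewrite ler1n; lia.
have jmR : (j%:R : R) <= m%:R by rewrite ler_nat; lia.
pose a : R := (j%:R - 1) / m%:R; pose b : R := j%:R / m%:R.
have ab : a < b by rewrite ltr_pM2r ?invr_gt0// ltrBlDr ltrDl.
pose p : {poly R} := m%:R *: 'X - (j%:R - 1)%:P.
have pE x : p.[x] = m%:R * x - (j%:R - 1) by rewrite /p !hornerE.
have pa : p.[a] = 0 by rewrite pE /a mulrC divfK ?gt_eqF// subrr.
have pb : p.[b] = 1 by rewrite pE /b mulrC divfK ?gt_eqF//; ring.
have dp : p^`()%R = m%:R%:P.
  by rewrite /p derivB derivZ derivX derivC subr0 alg_polyC.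
have dpE : (horner p)^`()%classic = fun=> m%:R.
  by rewrite -derivE dp; apply/funext => x; rewrite hornerC.
transitivity (\int[lebesgue_measure]_(x in `]a, b]) (m%:R * q.[p.[x]])%:E)%E.
  rewrite integral_mkcond [RHS]integral_mkcond; apply: eq_integral => x _.
  rewrite !patchE !mem_setE !in_itv/= /cut_poly -pE.
  have -> : (a < x <= b) = (0 < p.[x] <= 1).
    rewrite pE /a /b ltr_pdivrMr// ler_pdivlMr// subr_gt0 lerBlDr [x * _]mulrC.
    by congr (_ && (_ <= _)); ring.
  case: (boolP (0 < p.[x] <= 1)) => [|_]; last by rewrite mulr0; case: ifP.
  rewrite pE => /andP[px0 px1]; rewrite (_ : 0 <= x <= 1 = true)//.
  rewrite -(ler_pM2l mR) mulr0 -(ler_pM2l mR x) mulr1.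
  by apply/andP; split; lra.
rewrite integral_itv_obnd_cbnd; last first.
  apply: measurable_funTS; apply/measurable_EFinP.
  apply: measurable_funM; first exact: measurable_cst.
  under eq_fun do rewrite -horner_comp; exact: measurable_poly.
transitivity (\int[lebesgue_measure]_(x in `[p.[a], p.[b]]) q.[x]%:E)%E; last first.
  by rewrite pa pb.
rewrite (@integration_by_substitution_increasing _ (horner p) (horner q))//.
- by apply: eq_integral => x _; rewrite dpE/= mulrC.
- exact: ltW.
- by move=> x y _ _ xy; rewrite !pE ltrD2r ltr_pM2l.
- by rewrite dpE => x _; exact: cvg_cst.
- by rewrite dpE; exact: is_cvg_cst.
- by rewrite dpE; exact: is_cvg_cst.
- split.
  + by move=> x _; exact: derivable_horner.
  + by apply: cvg_at_right_filter; exact: continuous_horner.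
  + by apply: cvg_at_left_filter; exact: continuous_horner.
- by apply: continuous_subspaceT; exact: continuous_horner.
Qed.

Lemma cut_poly_sum (c : 'I_r.+1 -> R) x :
  \sum_(i < r.+1) c i * cut_poly (Q i) x =
  cut_poly (\sum_(i < r.+1) c i *: Q i) x.
Proof.
have [x01|x01] := boolP (0 < x <= 1); last first.
  by rewrite cut_poly_out// big1// => i _; rewrite cut_poly_out// mulr0.
rewrite cut_polyE// horner_sum; apply: eq_bigr => i _.
by rewrite cut_polyE// hornerZ.
Qed.

Hypothesis Q_basis : poly_orthonormal_basis Q.

(** Parseval identity for the orthonormal family [Q]. *)
Lemma integral_poly_sqr (c : 'I_r.+1 -> R) :
  (\int[lebesgue_measure]_(x in `[0%R, 1%R])
     ((\sum_(i < r.+1) c i *: Q i) ^+ 2).[x]%:E = (\sum_(i < r.+1) c i ^+ 2)%:E)%E.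
Proof.
have [_ Q_orth _] := Q_basis.
have ipoly (q : {poly R}) : lebesgue_measure.-integrable `[0%R, 1%R] (EFin \o horner q).
  apply: continuous_compact_integrable; first exact: segment_compact.
  by apply: continuous_subspaceT; exact: continuous_horner.
have iZ (k : R) q : (\int[lebesgue_measure]_(x in `[0%R, 1%R]) (k *: q).[x]%:E =
   k%:E * \int[lebesgue_measure]_(x in `[0%R, 1%R]) q.[x]%:E)%E.
  under eq_integral do rewrite hornerZ EFinM.
  by rewrite integralZl//; exact: (ipoly q).
have isum (F : 'I_r.+1 -> {poly R}) :
  (\int[lebesgue_measure]_(x in `[0%R, 1%R]) (\sum_(i < r.+1) F i).[x]%:E =
   \sum_(i < r.+1) \int[lebesgue_measure]_(x in `[0%R, 1%R]) (F i).[x]%:E)%E.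
  under eq_integral do rewrite horner_sum -sumEFin.
  by rewrite integral_sum// => i; exact: (ipoly (F i)).
rewrite expr2 big_distrlr/= isum -sumEFin; apply: eq_bigr => i _.
rewrite isum (bigD1 i)//= big1 ?adde0 => [|k ki].
  rewrite -scalerAl -scalerAr !iZ.
  under eq_integral do rewrite hornerM.
  by rewrite Q_orth eqxx mule1 -EFinM expr2.
rewrite -scalerAl -scalerAr !iZ.
under eq_integral do rewrite hornerM.
by rewrite Q_orth eq_sym (negPf ki) !mule0.
Qed.

(** The functions [phi] form an orthonormal family: distinct [j] have disjoint
    supports, and on one cell the rescaling reduces the claim to the
    orthonormality of [Q]. *)
Lemma integral_phi_sqr m (c : 'I_r.+1 -> nat -> R) : (0 < m)%N ->
  (\int[lebesgue_measure]_(x in `[0%R, 1%R])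
     ((\sum_(i < r.+1) \sum_(1 <= j < m.+1) c i j * phi Q m i j x) ^+ 2)%:E =
   (\sum_(i < r.+1) \sum_(1 <= j < m.+1) c i j ^+ 2)%:E)%E.
Proof.
move=> m0; pose p j := \sum_(i < r.+1) c i j *: Q i.
pose A j (x : R) := m%:R * cut_poly (p j ^+ 2) (m%:R * x - (j%:R - 1)).
have sqrE x : (\sum_(i < r.+1) \sum_(1 <= j < m.+1) c i j * phi Q m i j x) ^+ 2 =
    \sum_(1 <= j < m.+1) A j x.
  rewrite exchange_big/=.
  have uJ : uniq (index_iota 1 m.+1) by exact: iota_uniq.
  have AE j : A j x = (\sum_(i < r.+1) c i j * phi Q m i j x) ^+ 2.
    rewrite (eq_bigr (fun i => Num.sqrt m%:R *
      (c i j * cut_poly (Q i) (m%:R * x - (j%:R - 1))))).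
      rewrite -mulr_sumr cut_poly_sum exprMn sqr_sqrtr ?ler0n// /A /p; congr (_ * _).
      by rewrite /cut_poly; case: ifP => _; rewrite ?horner_exp// expr0n.
    by move=> i _; rewrite /phi mulrCA.
  have A0 j : ~~ in_cell (m%:R * x) j -> \sum_(i < r.+1) c i j * phi Q m i j x = 0.
    by move=> xj; rewrite big1// => i _; rewrite phi_out// mulr0.
  have A0' j : ~~ in_cell (m%:R * x) j -> A j x = 0.
    by move=> xj; rewrite AE A0// expr0n.
  case: (sum_in_cell (m%:R * x) uJ) => [h|[k h]].
    by rewrite !h// expr0n.
  by rewrite !h.
under eq_integral do rewrite sqrE -sumEFin.
rewrite exchange_big/= -sumEFin ge0_integral_sum//; last 2 first.
- move=> j; apply: measurable_funTS; apply/measurable_EFinP.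
  apply: measurable_funM; first exact: measurable_cst.
  apply: (measurableT_comp (measurable_cut_poly _)).
  apply: measurable_funB; last exact: measurable_cst.
  by apply: measurable_funM; [exact: measurable_cst|exact: measurable_id].
- move=> j x _; rewrite lee_fin mulr_ge0// /cut_poly; case: ifP => // _.
  by rewrite horner_exp sqr_ge0.
rewrite big_nat [RHS]big_nat; apply: eq_bigr => j /andP[j0 jm].
by rewrite integral_cell ?integral_poly_sqr// j0.
Qed.

End phi_family.

(** * Sup norms, total variations and powers *)

Section norms.
Context (R : realType).

Lemma tv_norm_ge0_fin (nu : {charge set R -> \bar R}) :
  (0 <= tv_norm nu)%E && (tv_norm nu \is a fin_num).
Proof.
rewrite /tv_norm; case: cid => A [B AB] /=; case: cid => B' AB' /=.
by rewrite measure_ge0 fin_num_measure.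
Qed.

Lemma tv_norm_ge0 (nu : {charge set R -> \bar R}) : 0 <= fine (tv_norm nu).
Proof. by have /andP[h _] := tv_norm_ge0_fin nu; rewrite fine_ge0. Qed.

Lemma tv_normE (nu : {charge set R -> \bar R}) :
  tv_norm nu = (fine (tv_norm nu))%:E.
Proof. by have /andP[_ h] := tv_norm_ge0_fin nu; rewrite fineK. Qed.

Lemma sup_norm_cut_polyE (q : {poly R}) :
  sup_norm (cut_poly q) = (fine (sup_norm (cut_poly q)))%:E.
Proof.
have [M qM] := bounded_cut_poly q; rewrite fineK// fin_numE -ltNye -ltey.
apply/andP; split.
  apply: lt_le_trans (ltNyr `|cut_poly q 0|) _.
  by apply: ereal_sup_ubound; exists 0.
apply: le_lt_trans (ltry M); apply: ge_ereal_sup => _ [x _ <-].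
by rewrite lee_fin.
Qed.

Lemma cut_poly_le_sup (q : {poly R}) x :
  `|cut_poly q x| <= fine (sup_norm (cut_poly q)).
Proof.
by rewrite -lee_fin -sup_norm_cut_polyE; apply: ereal_sup_ubound; exists x.
Qed.

(** On an interval of length 1 the L2 norm is at most the sup norm.  This is
    why the first power of the sup norm may be replaced by its cube in the
    final bound. *)
Lemma unit_sup_norm_ge1 (q : {poly R}) :
  (\int[lebesgue_measure]_(x in `[0%R, 1%R]) (q.[x] * q.[x])%:E = 1)%E ->
  1 <= fine (sup_norm (cut_poly q)).
Proof.
set S := fine _ => q1.
have S0 : 0 <= S by rewrite (le_trans _ (cut_poly_le_sup q 0)).
rewrite -(@ler_pXn2r _ 2) ?nnegrE// expr1n -lee_fin -[leLHS]q1.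
rewrite -integral_itv_obnd_cbnd; last first.
  apply: measurable_funTS; apply/measurable_EFinP.
  by apply: measurable_funM; exact: measurable_poly.
apply: (@le_trans _ _ (\int[lebesgue_measure]_(x in `]0%R, 1%R]) (S ^+ 2)%:E)%E).
  apply: ge0_le_integral_nomeas => x /=; rewrite in_itv/= => x01; rewrite lee_fin -expr2.
    exact: sqr_ge0.
  rewrite -real_normK ?num_real//.
  by rewrite lerXn2r ?nnegrE// -cut_polyE// cut_poly_le_sup.
rewrite integral_cst//= lebesgue_measure_itv/= lte01 oppr0 adde0 mule1.
by [].
Qed.

End norms.

Section powers.
Context (R : realType).

(** If a <= s, the first term suffices; otherwise a^(p-2) <= s^(p-2) because
    p <= 2.  Integrating this and optimizing in [s] does the work of the Jensen
    inequality E a^p <= (E a^2)^(p/2), up to a factor 2. *)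
Lemma powR_le_split (a s p : R) : 0 <= a -> 0 < s -> 0 <= p -> p <= 2 ->
  a `^ p <= s `^ p + s `^ (p - 2) * a ^+ 2.
Proof.
move=> a0 s0 p0 p2; have [le_as|lt_sa] := lerP a s.
  rewrite (le_trans (ge0_ler_powR p0 _ _ le_as)) ?nnegrE// ?(ltW s0)//.
  by rewrite lerDl mulr_ge0 ?powR_ge0 ?sqr_ge0.
have a_gt0 : 0 < a by exact: lt_trans lt_sa.
apply: (@le_trans _ _ (s `^ (p - 2) * a ^+ 2)); last by rewrite lerDr powR_ge0.
rewrite -[leLHS](_ : a `^ (p - 2) * a ^+ 2 = _); last first.
  rewrite -powR_mulrn// -powRD ?subrK//.
  by apply/implyP => _; rewrite gt_eqF.
rewrite ler_wpM2r ?sqr_ge0// -opprB !powRN lef_pV2 ?posrE ?powR_gt0//.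
by rewrite ge0_ler_powR ?nnegrE ?subr_ge0// ?(ltW s0) ?(ltW lt_sa).
Qed.

(** The choice s = D^(1/2) balances the two terms; for D = 0, let s tend
    to 0. *)
Lemma optimize_split (L : \bar R) (D p : R) : 0 <= D -> 0 < p ->
  (forall s, 0 < s -> (L <= (s `^ p + s `^ (p - 2) * D)%:E)%E) ->
  (L <= (2 * D `^ (p / 2))%:E)%E.
Proof.
move=> D0 p0 Ls; move: D0; rewrite le_eqVlt => /predU1P[D0|D0].
  rewrite -D0 powR0 ?mulr0; last by rewrite gt_eqF// divr_gt0.
  apply/lee_addgt0Pr => e e0; rewrite add0e.
  have := Ls (e `^ p^-1) (powR_gt0 _ e0).
  by rewrite -D0 mulr0 addr0 -powRrM mulVf ?gt_eqF// powRr1 ?(ltW e0)//.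
have := Ls (D `^ 2^-1) (powR_gt0 _ D0).
rewrite -!powRrM -[X in _ + _ * X]powRr1 ?(ltW D0)// -powRD; last first.
  by apply/implyP => _; rewrite gt_eqF.
have -> : 2^-1 * (p - 2) + 1 = p / 2 by field.
by rewrite [2^-1 * p]mulrC -mulr2n mulr_natl.
Qed.

End powers.

(** * The centered estimator and the risk bound *)

Section estimator.
Context (R : realType) (d : measure_display) (T : measurableType d)
  (P : probability T R) (Y : int -> {RV P >-> R})
  (r : nat) (Q : 'I_r.+1 -> {poly R}).

Definition centered_coef m n i j w : R :=
  emp_coef Q Y m n i j w - \int[P]_w emp_coef Q Y m n i j w.

Lemma bounded_mfun_phi m i j k : bounded_mfun (fun w => phi Q m i j (Y k w)).
Proof.
apply: bounded_mfun_comp; first exact: measurable_phi.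
have [M QM] := bounded_cut_poly (Q i).
by exists (Num.sqrt m%:R * M) => x; exact: phi_le.
Qed.

Lemma bounded_mfun_emp_coef m n i j : bounded_mfun (emp_coef Q Y m n i j).
Proof.
apply: bounded_mfunZ; apply: bounded_mfun_sum => k; exact: bounded_mfun_phi.
Qed.

Lemma bounded_mfun_centered_coef m n i j : bounded_mfun (centered_coef m n i j).
Proof.
by apply: bounded_mfunB; [exact: bounded_mfun_emp_coef|exact: bounded_mfun_cst].
Qed.

Lemma estimator_centered m n w x :
  ((estimator Q Y m n w x)%:E - 'E_P[fun w' => estimator Q Y m n w' x] =
   (\sum_(i < r.+1) \sum_(1 <= j < m.+1)
      centered_coef m n i j w * phi Q m i j x)%:E)%E.
Proof.
have bt i j : bounded_mfun (fun w => emp_coef Q Y m n i j w * phi Q m i j x).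
  by apply: bounded_mfunM; [exact: bounded_mfun_emp_coef|exact: bounded_mfun_cst].
have bs i : bounded_mfun (fun w =>
    \sum_(1 <= j < m.+1) emp_coef Q Y m n i j w * phi Q m i j x).
  exact: bounded_mfun_sum.
rewrite expectation.unlock bounded_mfun_integral; last exact: bounded_mfun_sum.
rewrite -EFinB; congr (_%:E); rewrite /estimator mean_sum// -sumrB.
apply: eq_bigr => i _; rewrite mean_sum// -sumrB.
apply: eq_bigr => j _; rewrite -[in RHS](mean_cst P (phi Q m i j x)).
under [X in _ - X]eq_Rintegral do rewrite mulrC.
rewrite meanZl; last exact: bounded_mfun_emp_coef.
by rewrite mean_cst /centered_coef; ring.
Qed.

Context (Q_basis : poly_orthonormal_basis Q).

(** The power is split at the level [s], and the integral of the square is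
    computed by orthonormality. *)
Lemma integral_error_le m n p s w : (0 < m)%N -> 0 < s -> 0 <= p -> p <= 2 ->
  (\int[lebesgue_measure]_(x in `[0%R, 1%R])
       `| (estimator Q Y m n w x)%:E
          - 'E_P[fun w' => estimator Q Y m n w' x] | `^ p <=
   (s `^ p + s `^ (p - 2) *
     \sum_(i < r.+1) \sum_(1 <= j < m.+1) centered_coef m n i j w ^+ 2)%:E)%E.
Proof.
move=> m0 s0 p0 p2.
pose g x := \sum_(i < r.+1) \sum_(1 <= j < m.+1)
  centered_coef m n i j w * phi Q m i j x.
have mg : measurable_fun (`[0%R, 1%R]%classic : set R) (fun x => (g x ^+ 2)%:E).
  apply: measurable_funTS; apply/measurable_EFinP; apply: measurable_funX.
  apply: measurable_sum => i; apply: measurable_sum => j.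
  by apply: measurable_funM; [exact: measurable_cst|exact: measurable_phi].
apply: (@le_trans _ _ (\int[lebesgue_measure]_(x in `[0%R, 1%R])
   ((s `^ p)%:E + (s `^ (p - 2))%:E * (g x ^+ 2)%:E))%E).
  apply: ge0_le_integral_nomeas => x _; first exact: poweR_ge0.
  rewrite estimator_centered abse_EFin poweR_EFin -EFinM -EFinD lee_fin -/(g x).
  by rewrite -[g x ^+ 2]real_normK ?num_real//; exact: powR_le_split.
rewrite ge0_integralD//=.
- rewrite integral_cst//= lebesgue_measure_itv/= lte01 oppr0 adde0 mule1.
  rewrite ge0_integralZl_EFin ?powR_ge0//; last by move=> x _; rewrite lee_fin sqr_ge0.
  by rewrite (integral_phi_sqr Q_basis)// -EFinM -EFinD.
- by move=> x _; rewrite lee_fin powR_ge0.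
- by move=> x _; rewrite mule_ge0 ?lee_fin ?powR_ge0 ?sqr_ge0.
- exact: measurable_funeM.
Qed.

Lemma mean_integral_error_le m n p s : (0 < m)%N -> 0 < s -> 0 <= p -> p <= 2 ->
  (\int[P]_w \int[lebesgue_measure]_(x in `[0%R, 1%R])
       `| (estimator Q Y m n w x)%:E
          - 'E_P[fun w' => estimator Q Y m n w' x] | `^ p <=
   (s `^ p + s `^ (p - 2) *
     \sum_(i < r.+1) \sum_(1 <= j < m.+1)
        \int[P]_w (centered_coef m n i j w ^+ 2))%:E)%E.
Proof.
move=> m0 s0 p0 p2.
have bc i j : bounded_mfun (fun w => centered_coef m n i j w ^+ 2).
  under eq_fun do rewrite expr2.
  by apply: bounded_mfunM; exact: bounded_mfun_centered_coef.
have bs i : bounded_mfun (fun w => \sum_(1 <= j < m.+1) centered_coef m n i j w ^+ 2).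
  exact: bounded_mfun_sum.
have bss : bounded_mfun (fun w =>
    \sum_(i < r.+1) \sum_(1 <= j < m.+1) centered_coef m n i j w ^+ 2).
  exact: bounded_mfun_sum.
apply: (@le_trans _ _ (\int[P]_w (s `^ p + s `^ (p - 2) *
    \sum_(i < r.+1) \sum_(1 <= j < m.+1) centered_coef m n i j w ^+ 2)%:E)%E).
  apply: ge0_le_integral_nomeas => w _; last exact: integral_error_le.
  by apply: integral_ge0 => x _; exact: poweR_ge0.
rewrite bounded_mfun_integral; last first.
  by apply: bounded_mfunD; [exact: bounded_mfun_cst|exact: bounded_mfunZ].
rewrite lee_fin meanD; [|exact: bounded_mfun_cst|exact: bounded_mfunZ].
rewrite mean_cst meanZl// mean_sum//.
by under eq_bigr do rewrite mean_sum//.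
Qed.

Context (Y_stationary : strictly_stationary Y).
Hypothesis Y_law : forall (k : nat) B, measurable B ->
  distribution P (Y k%:Z) B = distribution P (Y 0) B.
Context (kappa : nat -> R.-pker (past Y 0) ~> R)
  (kappa_cond : forall k : nat, is_cond_distribution (Y k%:Z) (kappa k))
  (dR : 'I_r.+1 -> {charge set R -> \bar R})
  (dR_diff : forall i, is_differential (cut_poly (Q i)) (dR i)).

Let supQ i := fine (sup_norm (cut_poly (Q i))).
Let tvQ i := fine (tv_norm (dR i)).

(** The function [phi] contributes a factor m^(1/2) both to the mass of its
    mixture of half-lines and to the sum over [j] of its absolute values; hence
    the factor m. *)
Lemma sum_variance_le m n i : (0 < m)%N -> (0 < n)%N ->
  \sum_(1 <= j < m.+1) \int[P]_w (centered_coef m n i j w ^+ 2) <=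
  2 * (m%:R / n%:R) * (supQ i * tvQ i) *
    \sum_(0 <= h < n.+1) beta_coef (kappa h).
Proof.
move=> m0 n0.
(* In absolute value, so as to be nonnegative in h. *)
pose cov j h := `|\int[P]_w (phi Q m i j (Y 0 w) * phi Q m i j (Y h%:Z w)) -
                  (\int[P]_w phi Q m i j (Y 0 w)) * (\int[P]_w phi Q m i j (Y h%:Z w))|.
have phib j : exists M, forall x, `|phi Q m i j x| <= M.
  by exists (Num.sqrt m%:R * supQ i) => x; apply: phi_le => y; exact: cut_poly_le_sup.
have mean_phi j (k : nat) :
    \int[P]_w phi Q m i j (Y k%:Z w) = \int[P]_w phi Q m i j (Y 0 w).
  apply: mean_eq_law (phib j); last exact: measurable_phi.
  by move=> B mB; rewrite Y_law.
apply: (@le_trans _ _ (\sum_(1 <= j < m.+1) (2 / n%:R * \sum_(0 <= h < n.+1) cov j h))).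
  apply: ler_sum => j _.
  apply: (variance_average_le (Z := fun k w => phi Q m i j (Y k%:Z w))) => //.
  - by move=> k; exact: bounded_mfun_phi.
  - by move=> h; exact: normr_ge0.
  move=> k h; rewrite (mean_pair_shift Y_stationary)//; last exact: measurable_phi.
  by rewrite !mean_phi; apply: le_trans (ler_norm _) _; rewrite /cov mean_phi.
rewrite -mulr_sumr exchange_big/=.
have -> : 2 * (m%:R / n%:R) * (supQ i * tvQ i) *
    (\sum_(0 <= h < n.+1) beta_coef (kappa h)) =
    2 / n%:R * (m%:R * (supQ i * tvQ i) *
    \sum_(0 <= h < n.+1) beta_coef (kappa h)) by ring.
rewrite ler_wpM2l ?divr_ge0// [leRHS]mulr_sumr; apply: ler_sum => h _.
have -> : m%:R * (supQ i * tvQ i) =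
    (Num.sqrt m%:R * supQ i) * (Num.sqrt m%:R * tvQ i).
  by rewrite mulrACA -expr2 sqr_sqrtr.
apply: (sum_cov_le (kappa_cond h) _ (g := phi Q m i) (M := Num.sqrt m%:R * supQ i)).
- by move=> t; exact: Y_law.
- by move=> j; exact: measurable_phi.
- by move=> j x; apply: phi_le => y; exact: cut_poly_le_sup.
- by move=> j; exact: phi_step_approximable.
- by move=> x; apply: sum_phi_le; [exact: iota_uniq|exact: cut_poly_le_sup].
Qed.

End estimator.

Theorem proposition4p2 (R : realType) (d : measure_display)
    (T : measurableType d) (P : probability T R)
    (Y : int -> {RV P >-> R}) (f : R -> R)
    (Y_stationary : strictly_stationary Y)
    (Y_density : forall i : int, has_density (Y i) f)
    (kappa : nat -> R.-pker (past Y 0) ~> R)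
    (kappa_cond : forall k : nat, is_cond_distribution (Y k%:Z) (kappa k))
    (r : nat) (Q : 'I_r.+1 -> {poly R})
    (Q_basis : poly_orthonormal_basis Q)
    (dR : 'I_r.+1 -> {charge set R -> \bar R})
    (dR_diff : forall i, is_differential (cut_poly (Q i)) (dR i))
    (m : nat -> nat) (m_gt0 : forall n, (0 < n)%N -> (0 < m n)%N)
    (p : R) (p_ge1 : 1 <= p) (p_le2 : p <= 2) :
  exists C : R, 0 < C /\ forall n : nat, (0 < n)%N ->
    (\int[P]_w \int[lebesgue_measure]_(x in `[0%R, 1%R])
       `| (estimator Q Y (m n) n w x)%:E
          - 'E_P[fun w' => estimator Q Y (m n) n w' x] | `^ p
     <= C%:E * (((m n)%:R / n%:R) `^ (p / 2))%:E
          * C12 Q dR `^ (p / 2) * V12 kappa n `^ (p / 2))%E.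
Proof.
have p_gt0 : 0 < p by exact: lt_le_trans p_ge1.
exists (2 * 2 `^ (p / 2)); split; first by rewrite mulr_gt0 ?powR_gt0.
move=> n n0; have m0 := m_gt0 n n0.
pose S i := fine (sup_norm (cut_poly (Q i))).
pose V i := fine (tv_norm (dR i)).
pose K := \sum_(i < r.+1) S i ^+ 3 * V i.
pose B := \sum_(0 <= h < n.+1) beta_coef (kappa h).
have S1 i : 1 <= S i.
  by apply: unit_sup_norm_ge1; have [_ -> _] := Q_basis; rewrite eqxx.
have K0 : 0 <= K.
  apply: sumr_ge0 => i _; rewrite mulr_ge0 ?tv_norm_ge0// exprn_ge0//.
  exact: le_trans (S1 i).
have B0 : 0 <= B by apply: sumr_ge0 => h _; exact: beta_coef_ge0.
have C12E : C12 Q dR = K%:E.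
  rewrite /C12 /K -sumEFin; apply: eq_bigr => i _.
  by rewrite sup_norm_cut_polyE tv_normE -EFin_expe -EFinM.
have V12E : V12 kappa n = B%:E.
  by rewrite /V12 /B -sumEFin; apply: eq_bigr => h _; rewrite -beta_coefE.
have mn0 : 0 <= (m n)%:R / n%:R :> R by rewrite divr_ge0.
rewrite C12E V12E !poweR_EFin -!EFinM.
have -> : 2 * 2 `^ (p / 2) * ((m n)%:R / n%:R) `^ (p / 2) * K `^ (p / 2) *
    B `^ (p / 2) = 2 * (2 * ((m n)%:R / n%:R) * K * B) `^ (p / 2).
  by rewrite (@powRM _ (_ * K)) ?(@powRM _ _ K) ?(@powRM _ 2) ?mulr_ge0//; ring.
apply: optimize_split => //; first by rewrite !mulr_ge0.
move=> s s0.
apply: le_trans (mean_integral_error_le Y Q_basis n m0 s0 (ltW p_gt0) p_le2) _.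
rewrite lee_fin lerD2l ler_wpM2l ?powR_ge0//.
have Y_law (k : nat) A : measurable A ->
    distribution P (Y k%:Z) A = distribution P (Y 0) A.
  by move=> mA; have [_ _ ->] := Y_density k%:Z => //; have [_ _ ->] := Y_density 0.
apply: (@le_trans _ _ (\sum_(i < r.+1) 2 * ((m n)%:R / n%:R) * (S i * V i) * B)).
  apply: ler_sum => i _.
  exact: (sum_variance_le Y_stationary Y_law kappa_cond dR_diff).
rewrite -mulr_suml -mulr_sumr -/B ler_wpM2r// ler_wpM2l ?mulr_ge0//.
apply: ler_sum => i _; rewrite ler_wpM2r ?tv_norm_ge0//.
by rewrite exprS ler_peMr ?expr_ge1// (le_trans _ (S1 i)).
Qed.
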